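(* Let $H = T_H \rtimes H_0$ be a split, locally compact subgroup of $\operatorname{Isom}(\mathbb{E}^n)$. Let $\widetilde{H}_0$ be the essential part of $H_0$, and write $\operatorname{CL}$ for the conjugator length function of $H$. Then: (1) $\operatorname{CL}$ has trivial (i.e., zero) growth if, and only if, the spherical part $H_0$ and the translation part $T_H$ of $H$ commute. Suppose now that $T_H$ and $H_0$ do not commute. Then: (2) $\operatorname{CL}$ grows linearly if, and only if, $\widetilde{H}_0$ is discrete. (3) $\operatorname{CL}$ is unbounded, in the sense that $\operatorname{CL}(m) = \infty$ for all but finitely many $m \in \mathbb{N}$, if, and only if, $\widetilde{H}_0$ is not discrete.
   Context: Write $\operatorname{Isom}(\mathbb{E}^n) = T \rtimes \operatorname{O}(n)$ with its usual Lie group topology, where $T = \{t^\lambda : \lambda \in \mathbb{R}^n\} \cong \mathbb{R}^n$ is the group of translations and $t^\lambda$ is translation by $\lambda$. A subgroup $H$ is split if $H = T_H \rtimes H_0$ with $T_H = T \cap H$ (translation part) and $H_0 = H \cap \operatorname{O}(n)$ (spherical part); for a topological subgroup (subspace topology) the splitting is required to be topological. ''$T_H$ and $H_0$ commute'' means every element of $T_H$ commutes with every element of $H_0$. All topological groups are Hausdorff. Translation lattice: $L_H = \{\lambda \in \mathbb{R}^n : t^\lambda \in T_H\}$; $V = \operatorname{Span}_{\mathbb{R}}(L_H)$, which is $H_0$-invariant. The essential part of $H_0$ is $\widetilde{H}_0 = \{h_0|_V : h_0 \in H_0\} \le \operatorname{O}(V)$ (with the topology of $\operatorname{O}(V)$).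 Conjugator length: a locally compact split $H$ is compactly generated; fix a compact generating set $S$ with word length $\ell_S$. For conjugate $h, h' \in H$ put $\mathrm{c}\ell(h,h') = \min\{\ell_S(k) : k \in H,\ khk^{-1} = h'\}$. For $m \in \mathbb{N} = \{0,1,2,\dots\}$ put $\operatorname{CL}(m) = \sup\{\mathrm{c}\ell(h,h') : h, h' \text{ conjugate in } H,\ \ell_S(h) + \ell_S(h') \le m\} \in \mathbb{Z}_{\ge 0} \cup \{\infty\}$; by convention $\operatorname{CL}$ is constant equal to $0$ if $H$ is abelian. Extend to $r \in \mathbb{R}_{\ge 0}$ by $\operatorname{CL}(r) = \operatorname{CL}(\lceil r \rceil)$. Growth: for nondecreasing $f, g : \mathbb{R}_{\ge 0} \to \mathbb{R}_{\ge 0} \cup \{\infty\}$, $g$ quasi-dominates $f$ (written $f \preccurlyeq g$) if there is an increasing affine function $a(r) = Cr + D$ with $C, D \in \mathbb{R}$, $C > 0$ (and $a(\infty) = \infty$), such that $f(r) \le a(g(a(r)))$ for all $r \ge 0$ with $a(r) \ge 0$. $f, g$ are quasi-equivalent if $f \preccurlyeq g$ and $g \preccurlyeq f$. $f$ has trivial (zero) growth if it is quasi-equivalent to a constant function with finite value, and grows linearly if it is quasi-equivalent to $r \mapsto r$. The growth rate of $\operatorname{CL}$ does not depend on $S$. *)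

(* Defs.v *)
From HB Require Import structures.
From mathcomp Require Import all_boot all_order all_algebra.
From mathcomp Require Import all_classical all_reals all_analysis.

Set Implicit Arguments.
Unset Strict Implicit.
Unset Printing Implicit Defensive.

Import Order.TTheory GRing.Theory Num.Theory.
Import numFieldNormedType.Exports.

Local Open Scope classical_set_scope.
Local Open Scope ring_scope.

Definition orthogonal_mx (R : realType) (n : nat) : pred 'M[R]_n :=
  fun A => A^T *m A == 1%:M.

(* Isom(E^n) = R^n x| O(n): the pair (v, A) stands for the isometry
   x |-> A *m x + v. *)
Record isom (R : realType) (n : nat) := Isom {
  isom_val : 'cV[R]_n * 'M[R]_n;
  _ : orthogonal_mx isom_val.2 }.

HB.instance Definition _ R n := [isSub for @isom_val R n].
HB.instance Definition _ R n := [Choice of isom R n by <:].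
HB.instance Definition _ R n :=
  Topological.copy (isom R n) (initial_topology (@isom_val R n)).

Section IsomGroup.
Context {R : realType} {n : nat}.
Implicit Types g h k : isom R n.

Definition trans g : 'cV[R]_n := (isom_val g).1.
Definition lin g : 'M[R]_n := (isom_val g).2.

Lemma lin_orthogonal g : (lin g)^T *m lin g = 1%:M.
Proof. by rewrite /lin; case: g => p /= p_orth; apply/eqP. Qed.

Lemma lin_orthogonalV g : lin g *m (lin g)^T = 1%:M.
Proof. exact/mulmx1C/lin_orthogonal. Qed.

Lemma isom_eq g h : trans g = trans h -> lin g = lin h -> g = h.
Proof.
by move=> e1 e2; apply: val_inj; rewrite /= [LHS]surjective_pairing
  [RHS]surjective_pairing; congr pair.
Qed.

Fact isom_one_subproof : orthogonal_mx (0 : 'cV[R]_n, 1%:M : 'M[R]_n).2.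
Proof. by rewrite /orthogonal_mx /= trmx1 mulmx1. Qed.

Definition isom_one : isom R n := Isom isom_one_subproof.

Fact isom_mul_subproof g h :
  orthogonal_mx (trans g + lin g *m trans h, lin g *m lin h).2.
Proof.
rewrite /orthogonal_mx /= trmx_mul mulmxA -(mulmxA _ _ (lin g)).
by rewrite lin_orthogonal mulmx1 lin_orthogonal.
Qed.

Definition isom_mul g h : isom R n := Isom (isom_mul_subproof g h).

Fact isom_inv_subproof g :
  orthogonal_mx (- ((lin g)^T *m trans g), (lin g)^T).2.
Proof. by rewrite /orthogonal_mx /= trmxK lin_orthogonalV. Qed.

Definition isom_inv g : isom R n := Isom (isom_inv_subproof g).

Fact isom_mulA : associative isom_mul.
Proof.
move=> f g h; apply: isom_eq; rewrite /trans /lin /= ?mulmxA //.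
by rewrite mulmxDr addrA mulmxA.
Qed.

Fact isom_mul1 : left_id isom_one isom_mul.
Proof. by move=> g; apply: isom_eq; rewrite /trans /lin /= ?add0r !mul1mx. Qed.

Fact isom_mulr1 : right_id isom_one isom_mul.
Proof.
by move=> g; apply: isom_eq; rewrite /trans /lin /= ?mulmx0 ?addr0 ?mulmx1.
Qed.

Fact isom_mulV : left_inverse isom_one isom_inv isom_mul.
Proof.
move=> g; apply: isom_eq; rewrite /trans /lin /= ?lin_orthogonal //.
by rewrite addNr.
Qed.

Fact isom_mulrV : right_inverse isom_one isom_inv isom_mul.
Proof.
move=> g; apply: isom_eq; rewrite /trans /lin /= ?lin_orthogonalV //.
by rewrite mulmxN mulmxA lin_orthogonalV mul1mx subrr.
Qed.

HB.instance Definition _ := isGroup.Build (isom R n)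
  isom_mulA isom_mul1 isom_mulr1 isom_mulV isom_mulrV.

End IsomGroup.

Section Subgroups.
Context {R : realType} {n : nat}.
Implicit Types (H S : set (isom R n)) (g h k : isom R n).
Local Open Scope group_scope.

Definition translation_part H : set (isom R n) := H `&` [set g | lin g = 1%:M].

Definition spherical_part H : set (isom R n) := H `&` [set g | trans g = 0].

(* H = T_H x| H_0 as topological groups: multiplication is a homeomorphism from
   T_H x H_0 onto H.  Normality of T_H need not be stated: T_H is the kernel of
   the restriction of lin to H. *)
Definition split_subgroup H : Prop :=
  let D := translation_part H `*` spherical_part H in
  let mul := fun p : isom R n * isom R n => p.1 * p.2 in
  [/\ set_bij D H mul,
      {within D, continuous mul} &
      exists2 s : isom R n -> isom R n * isom R n,
        {within H, continuous s} & {in D, cancel mul s}].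

Definition parts_commute H : Prop :=
  forall t h, translation_part H t -> spherical_part H h -> commute t h.

Definition translation_lattice H : set 'cV[R]_n :=
  [set trans t | t in translation_part H].

Definition real_span (L : set 'cV[R]_n) : set 'cV[R]_n :=
  [set v | exists (k : nat) (a : 'I_k -> R) (l : 'I_k -> 'cV[R]_n),
     (forall i, L (l i)) /\ v = (\sum_(i < k) a i *: l i)%R].

(* The restrictions h_0|_V, for V the span of the translation lattice; V is
   H_0-invariant, so they take values in V.  On linear maps defined on the
   finite-dimensional space V, pointwise convergence is the usual topology of
   End(V), hence induces that of O(V). *)
Definition essential_part H
    : set {ptws real_span (translation_lattice H) ->
             ('cV[R]_n : topologicalType)} :=
  [set sigL (real_span (translation_lattice H)) (fun v => lin h *m v)
     | h in spherical_part H].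

Definition min_nat (A : set nat) : nat := xget 0%N (A `&` lbound A).

Definition is_word S (g : isom R n) (m : nat) : Prop :=
  exists w : seq (isom R n),
    [/\ size w = m, forall x, x \in w -> S x \/ S x^-1 & g = \prod_(x <- w) x].

(* Since S is contained in H, the words in S and S^-1 all lie in H. *)
Definition compact_generating_set H S : Prop :=
  [/\ compact S, S `<=` H & forall h, H h -> exists m, is_word S h m].

Definition word_length S g : nat := min_nat [set m | is_word S g m].

Definition conjugators H h h' : set (isom R n) :=
  [set k | H k /\ k * h * k^-1 = h'].

Definition conj_length H S h h' : nat :=
  min_nat [set word_length S k | k in conjugators H h h'].

(* For abelian H no convention is needed, see CL_abelian below. *)
Definition CL H S (m : nat) : \bar R :=
  ereal_sup [set ((conj_length H S p.1 p.2)%:R)%:E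
    | p in [set p : isom R n * isom R n |
        [/\ H p.1, H p.2, conjugators H p.1 p.2 !=set0 &
            (word_length S p.1 + word_length S p.2 <= m)%N]]].

Definition CL_real H S (r : R) : \bar R := CL H S `|Num.ceil r|%N.

End Subgroups.

Arguments essential_part {R n} H.

(* Discreteness of A in the subspace topology. *)
Definition discrete_set (T : topologicalType) (A : set T) : Prop :=
  A `<=` isolated A.

(* Functions on R_{>=0} are represented by total functions on R, of which only
   the values at nonnegative reals are used. *)
Section Growth.
Context {R : realType}.
Implicit Types f g : R -> \bar R.
Local Open Scope ereal_scope.

Definition quasi_dominated f g : Prop :=
  exists C D : R, (0 < C)%R /\
    forall r : R, (0 <= r)%R -> (0 <= C * r + D)%R ->
      f r <= C%:E * g (C * r + D)%R + D%:E.

Definition quasi_equivalent f g : Prop :=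
  quasi_dominated f g /\ quasi_dominated g f.

Definition trivial_growth f : Prop :=
  exists2 c : R, (0 <= c)%R & quasi_equivalent f (fun=> c%:E).

Definition linear_growth f : Prop := quasi_equivalent f (fun r => r%:E).

End Growth.

Section Abelian.
Context {R : realType} {n : nat}.
Local Open Scope group_scope.

Lemma min_nat_eq0 (A : set nat) : A 0%N -> min_nat A = 0%N.
Proof.
move=> A0; rewrite /min_nat; case: xgetP => // k -> [_ /(_ _ A0)].
by rewrite leEnat leqn0 => /eqP.
Qed.

Lemma CL_abelian (H S : set (isom R n)) (m : nat) : group_closed [in H] ->
  (forall h k, H h -> H k -> commute h k) -> CL H S m = 0%E.
Proof.
move=> [H1 _] cH; have {}H1 : H 1 by move: H1; rewrite inE.
have wl1 : word_length S 1 = 0%N.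
  by apply: min_nat_eq0; exists [::]; split=> //; rewrite big_nil.
have cl0 (h h' : isom R n) : H h -> conjugators H h h' !=set0 ->
    conj_length H S h h' = 0%N.
  move=> Hh [k [Hk <-]]; apply: min_nat_eq0; exists 1 => //.
  by split=> //; rewrite mul1g invg1 mulg1 (cH k h Hk Hh) mulgK.
rewrite /CL [X in ereal_sup X](_ : _ = [set 0%E]) ?ereal_sup1 //.
apply/seteqP; split=> [_ [[h h'] /= [Hh Hh' hh' _] <-]|_ -> /=].
  by rewrite cl0.
exists (1, 1) => /=; last by rewrite cl0 //; exists 1; split; rewrite // mul1g invg1 mulg1.
by split=> //; [exists 1; split; rewrite // mul1g invg1 mulg1 | rewrite wl1].
Qed.

End Abelian.

(* Main.v *)
Require Import Defs.
From mathcomp Require Import all_boot all_order all_algebra.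
From mathcomp Require Import all_classical all_reals all_analysis.
From mathcomp Require Import lra.

Set Implicit Arguments.
Unset Strict Implicit.
Unset Printing Implicit Defensive.

Import Order.TTheory GRing.Theory Num.Theory.
Import numFieldNormedType.Exports.

Local Open Scope classical_set_scope.
Local Open Scope ring_scope.

(* Since H = T_H x| H_0, conjugating (t, A) by (s, B) gives
   (s + B t - A' s, A') with A' = B A B^-1, so a conjugator is bounded once some
   short lattice vector s' satisfies (1 - A') s' = (1 - A') s.  Translation norm
   and word length are comparable: by Baire, some set of words of fixed length
   has interior in H, hence bounded parts of H have bounded word length, and
   lattice vectors are reached by walking along segments of V.

   Lower bound: if A in H_0 moves v in the lattice, then A is conjugate to
   (k (1 - A) v, A) only by elements of translation norm growing linearly in k.
   Upper bound, when the essential part is discrete: it is then finite, so A' has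
   bounded order on V; subtracting from s a lattice vector fixed by A' and close
   to the average of s under the powers of A' gives s'.
   If the essential part is not discrete, take A near 1 in the lower bound: with
   k (1 - A) v of norm between 1 and 2, both elements have bounded length, but
   every conjugator has norm at least 1 / |1 - A|. *)

(** * Norms of matrices *)

Section MatrixNorm.
Context {R : realType}.

Lemma mx_norm_le (m n : nat) (A : 'M[R]_(m, n)) (c : R) :
  0 <= c -> (forall i j, `|A i j| <= c) -> `|A| <= c.
Proof.
move=> c0 Ac; rewrite /Num.norm /= mx_normrE.
by apply/bigmax_leP; split=> // -[i j] _; exact: Ac.
Qed.

Lemma mx_norm_ge (m n : nat) (A : 'M[R]_(m, n)) i j : `|A i j| <= `|A|.
Proof.
rewrite [leRHS]/Num.norm /= mx_normrE.
by apply/bigmax_geP; right; exists (i, j).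
Qed.

Lemma mx_norm_mul (m n p : nat) (A : 'M[R]_(m, n)) (B : 'M[R]_(n, p)) :
  `|A *m B| <= n%:R * `|A| * `|B|.
Proof.
apply: mx_norm_le => [|i j]; first by rewrite !mulr_ge0.
rewrite mxE (le_trans (ler_norm_sum _ _ _)) //.
rewrite -mulrA -[n in n%:R]card_ord mulr_natl -sumr_const ler_sum // => k _.
by rewrite normrM ler_pM ?mx_norm_ge.
Qed.

Lemma mx_norm_tr (m n : nat) (A : 'M[R]_(m, n)) : `|A^T| = `|A|.
Proof.
suff le_tr p q (B : 'M[R]_(p, q)) : `|B^T| <= `|B|.
  by apply/eqP; rewrite eq_le le_tr -{1}[A]trmxK le_tr.
by apply: mx_norm_le => // i j; rewrite mxE mx_norm_ge.
Qed.

Lemma orthogonal_mx_norm (n : nat) (A : 'M[R]_n) : orthogonal_mx A -> `|A| <= 1.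
Proof.
move=> /eqP AA; apply: mx_norm_le => // i j.
have /matrixP/(_ j j) := AA; rewrite !mxE eqxx mulr1n => Aj.
rewrite -(@ler_pXn2r _ 2) ?nnegrE // expr1n real_normK ?num_real // -[leRHS]Aj.
rewrite (bigD1 i) //= !mxE expr2 lerDl sumr_ge0 // => k _.
by rewrite !mxE -expr2 sqr_ge0.
Qed.

(** The norm is the largest absolute value of an entry, which orthogonal matrices need not preserve;
    hence the factor [n] here and in later estimates. *)
Lemma orthogonal_mul_norm (n p : nat) (A : 'M[R]_n) (B : 'M[R]_(n, p)) :
  orthogonal_mx A -> `|A *m B| <= n%:R * `|B|.
Proof.
move=> /orthogonal_mx_norm A1; apply: le_trans (mx_norm_mul _ _) _.
by rewrite -mulrA ler_wpM2l // ler_piMl.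
Qed.

(* Sorting the entries into finitely many intervals of length [d]. *)
Lemma mx_grid (m n : nat) (r d : R) : 0 < d ->
  exists (F : finType) (c : 'M[R]_(m, n) -> F), forall A B,
    `|A| <= r -> `|B| <= r -> c A = c B -> `|A - B| <= d.
Proof.
move=> d0; have [r0|r0] := ltP r 0.
  exists unit, (fun=> tt) => A B Ar; have := normr_ge0 A; lra.
pose N := Num.truncn ((r + r) / d).
pose idx (x : R) := Num.truncn ((x + r) / d).
exists {ffun 'I_m * 'I_n -> 'I_N.+1}.
exists (fun A => [ffun ij => inord (idx (A ij.1 ij.2))]) => A B Ar Br cAB.
apply: mx_norm_le => [|i j]; first exact: ltW.
have entry (C : 'M[R]_(m, n)) : `|C| <= r ->
    (idx (C i j) < N.+1)%N /\
      (idx (C i j))%:R <= (C i j + r) / d < (idx (C i j)).+1%:R.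
  move=> Cr; have /ler_normlP[Cr1 Cr2] := le_trans (mx_norm_ge C i j) Cr.
  have C0 : 0 <= (C i j + r) / d by rewrite divr_ge0 ?(ltW d0) //; lra.
  split; last exact: truncn_itv.
  by rewrite ltnS le_truncn // ler_wpM2r ?invr_ge0 ?(ltW d0) // lerD2r.
have [/inordK iA Aij] := entry A Ar; have [/inordK iB Bij] := entry B Br.
have e : idx (A i j) = idx (B i j).
  by rewrite -iA -iB; have /ffunP/(_ (i, j)) := cAB; rewrite !ffunE => ->.
move: Aij Bij; rewrite !mxE e -natr1 !ler_pdivlMr // !ltr_pdivrMr //.
move=> /andP[A1 A2] /andP[B1 B2]; apply/ler_normlP; split; lra.
Qed.

End MatrixNorm.

(** * Approximation of a real span by the subgroup that spans it *)

Section CoarseSpan.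
Context {R : realType} {n : nat}.
Implicit Types (L : set 'cV[R]_n) (q v x : 'cV[R]_n).

(** A finite family in [L] whose span has the largest possible dimension already spans: adding a
    vector of [L] cannot enlarge it. *)
Lemma real_span_finite L : exists (k : nat) (l : 'I_k -> 'cV[R]_n),
  (forall i, L (l i)) /\
    forall q, real_span L q -> exists a : 'I_k -> R, q = \sum_i a i *: l i.
Proof.
pose P d := `[< exists X : seq 'cV[R]_n,
  (forall x, x \in X -> L x) /\ \dim <<X>>%VS = d >].
have exP : exists d, P d.
  by exists (\dim <<[::] : seq 'cV[R]_n>>); apply/asboolP; exists [::].
have ubP d : P d -> (d <= \dim {:'cV[R]_n})%N.
  by move=> /asboolP[X [_ <-]]; rewrite dimvS ?subvf.
have [d /asboolP[X [LX dX]] dmax] := ex_maxnP exP ubP.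
have LsubX v : L v -> v \in <<X>>%VS.
  move=> Lv; have Pv : P (\dim <<v :: X>>).
    apply/asboolP; exists (v :: X); split=> // x.
    by rewrite inE => /predU1P[->//|]; exact: LX.
  have XvX : (<<X>> <= <<v :: X>>)%VS by rewrite span_cons addvSr.
  have /eqP -> : <<X>>%VS == <<v :: X>>%VS by rewrite eqEdim XvX dX dmax.
  by rewrite memv_span ?mem_head.
exists (size X), (fun i => X`_i); split=> [i|q [k [a [l [Ll ->]]]]].
  exact/LX/mem_nth.
have : \sum_(i < k) a i *: l i \in <<in_tuple X>>%VS.
  by rewrite memv_suml // => i _; rewrite memvZ ?LsubX.
by move=> /coord_span qX; eexists; exact: qX.
Qed.

(** Rounding down the coordinates in a finite spanning family from [L] gives a vector of [L], at a
    distance of at most the sum of the norms of that family. *)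
Lemma real_span_coarse L : L 0 -> (forall x v, L x -> L v -> L (x - v)) ->
  exists2 D, 0 <= D &
    forall q, real_span L q -> exists2 f, L f & `|q - f| <= D.
Proof.
move=> L0 LB; have LN x : L x -> L (- x) by rewrite -sub0r; exact: LB.
have LD x v : L x -> L v -> L (x + v).
  by move=> Lx Lv; rewrite -[v]opprK; apply: LB => //; exact: LN.
have Lz x (z : int) : L x -> L (x *~ z).
  move=> Lx; have Ln m : L (x *+ m).
    by elim: m => [|m IH]; rewrite ?mulr0n // mulrS; exact: LD.
  by case: z => m; rewrite ?NegzE ?mulrNz -pmulrn //; exact/LN/Ln.
have [k [l [Ll spanL]]] := real_span_finite L.
exists (\sum_i `|l i|) => [|q /spanL[a ->]]; first exact: sumr_ge0.
exists (\sum_i l i *~ Num.floor (a i)).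
  by apply: (big_ind L) => // i _; exact: Lz.
rewrite -sumrB (le_trans (ler_norm_sum _ _ _)) // ler_sum // => i _.
rewrite -scaler_int -scalerBl normrZ ler_piMl // ger0_norm.
  by rewrite lerBlDl ltW // -[X in _ + X]/(1%:~R) -intrD floorD1_gt.
by rewrite subr_ge0 ge_floor.
Qed.

End CoarseSpan.

(** * Limits of matrices, entry by entry *)

Section MatrixLimits.
Context {R : realType} {T : Type} {F : set_system T} {FF : Filter F}.

Lemma cvg_mxP (m n : nat) (f : T -> 'M[R]_(m, n)) (A : 'M[R]_(m, n)) :
  (forall i j, f x i j @[x --> F] --> A i j) -> f x @[x --> F] --> A.
Proof.
move=> fA; apply/cvgrPdist_le => e e0.
have : \forall x \near F, forall ij : 'I_m * 'I_n,
    `|A ij.1 ij.2 - f x ij.1 ij.2| <= e.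
  apply: filter_forall => ij.
  exact: (cvgrPdist_le _ _).1 (fA ij.1 ij.2) _ e0.
apply: filterS => x Afx; apply: mx_norm_le => [|i j]; first exact: ltW.
by rewrite !mxE; exact: Afx (i, j).
Qed.

Lemma cvg_coord (m n : nat) (f : T -> 'M[R]_(m, n)) (A : 'M[R]_(m, n)) i j :
  f x @[x --> F] --> A -> f x i j @[x --> F] --> A i j.
Proof. by move=> fA; exact: cvg_comp fA (@coord_continuous R m n i j A). Qed.

Lemma cvg_mulmx (m n p : nat) (f : T -> 'M[R]_(m, n)) (g : T -> 'M[R]_(n, p))
    (A : 'M[R]_(m, n)) (B : 'M[R]_(n, p)) :
  f x @[x --> F] --> A -> g x @[x --> F] --> B ->
  f x *m g x @[x --> F] --> A *m B.
Proof.
move=> fA gB; apply: cvg_mxP => i j; rewrite mxE.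
under eq_fun do rewrite mxE.
apply: cvg_big => [|k _]; first exact: add_continuous.
by apply: cvgM; exact: cvg_coord.
Qed.

Lemma cvg_trmx (m n : nat) (f : T -> 'M[R]_(m, n)) (A : 'M[R]_(m, n)) :
  f x @[x --> F] --> A -> (f x)^T @[x --> F] --> A^T.
Proof.
move=> fA; apply: cvg_mxP => i j; rewrite mxE.
by under eq_fun do rewrite mxE; exact: cvg_coord.
Qed.

End MatrixLimits.

(** * The group of isometries as a metric space *)

Section IsomMetric.
Context {R : realType} {n : nat}.
Implicit Types (g h k : isom R n) (U : set (isom R n)).

Lemma lin_orth g : orthogonal_mx (lin g).
Proof. exact/eqP/lin_orthogonal. Qed.

Lemma trans1 : trans (1%g : isom R n) = 0. Proof. by []. Qed.
Lemma lin1 : lin (1%g : isom R n) = 1%:M. Proof. by []. Qed.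
Lemma transM g h : trans (g * h)%g = trans g + lin g *m trans h.
Proof. by []. Qed.
Lemma linM g h : lin (g * h)%g = lin g *m lin h. Proof. by []. Qed.
Lemma transV g : trans g^-1%g = - ((lin g)^T *m trans g). Proof. by []. Qed.
Lemma linV g : lin g^-1%g = (lin g)^T. Proof. by []. Qed.

Definition isom_dist g h : R := `|isom_val g - isom_val h|.

Lemma isom_distE g h :
  isom_dist g h = Num.max `|trans g - trans h| `|lin g - lin h|.
Proof. by rewrite /isom_dist prod_normE. Qed.

Lemma isom_dist_trans g h : `|trans g - trans h| <= isom_dist g h.
Proof. by rewrite isom_distE le_max lexx. Qed.

Lemma isom_dist_lin g h : `|lin g - lin h| <= isom_dist g h.
Proof. by rewrite isom_distE le_max lexx orbT. Qed.

Lemma isom_dist_le g h (c : R) :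
  `|trans g - trans h| <= c -> `|lin g - lin h| <= c -> isom_dist g h <= c.
Proof. by rewrite isom_distE ge_max => -> ->. Qed.

Lemma isom_distC g h : isom_dist g h = isom_dist h g.
Proof. exact: distrC. Qed.

Lemma isom_dist_triangle g h k :
  isom_dist g k <= isom_dist g h + isom_dist h k.
Proof. exact: ler_distD. Qed.

Lemma isom_distxx g : isom_dist g g = 0.
Proof. by rewrite /isom_dist subrr normr0. Qed.

Lemma isom_dist_mull g h k :
  isom_dist (k * g)%g (k * h)%g <= n%:R * isom_dist g h.
Proof.
apply: isom_dist_le.
  rewrite !transM opprD addrACA subrr add0r -mulmxBr.
  apply: le_trans (orthogonal_mul_norm _ (lin_orth k)) _.
  by rewrite ler_wpM2l // isom_dist_trans.
rewrite !linM -mulmxBr.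
apply: le_trans (orthogonal_mul_norm _ (lin_orth k)) _.
by rewrite ler_wpM2l // isom_dist_lin.
Qed.

Lemma nbhs_isomP g U :
  nbhs g U <-> exists2 e : R, 0 < e & forall h, isom_dist g h < e -> U h.
Proof.
split=> [[V [[B oB <-] /= Bg BU]]|[e e0 gU]].
  have /nbhs_ballP[e /= e0 eB] : nbhs (isom_val g) B by exact: open_nbhs_nbhs.
  exists e => // h gh; apply/BU/eB.
  by rewrite -ball_normE.
have /cvgrPdist_lt/(_ e e0) : isom_val h @[h --> g] --> isom_val g.
  exact: initial_continuous.
by apply: filterS => h; exact: gU.
Qed.

Lemma isom_hausdorff : hausdorff_space (isom R n).
Proof.
move=> g h gh; apply/val_inj/eqP; rewrite -subr_eq0 -normr_eq0.
apply: contrapT => /negP; rewrite -[`|_|]/(isom_dist g h) => gh_neq0.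
have e0 : 0 < isom_dist g h / 2 by rewrite divr_gt0 // lt0r gh_neq0 normr_ge0.
pose B k := [set l | isom_dist k l < isom_dist g h / 2].
have nB k : nbhs k (B k) by apply/nbhs_isomP; exists (isom_dist g h / 2).
have [k [gk]] := gh _ _ (nB g) (nB h); rewrite /B /= isom_distC => kh.
have := isom_dist_triangle g k h; move: gk; rewrite /B /=; lra.
Qed.

Lemma trans_continuous : continuous (@trans R n).
Proof.
by move=> g; exact: cvg_comp (@initial_continuous _ _ (@isom_val R n) g) cvg_fst.
Qed.

Lemma lin_continuous : continuous (@lin R n).
Proof.
by move=> g; exact: cvg_comp (@initial_continuous _ _ (@isom_val R n) g) cvg_snd.
Qed.

Lemma isom_mul_continuous :
  continuous (fun p : isom R n * isom R n => (p.1 * p.2)%g).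
Proof.
apply: continuous_comp_initial => p.
have c1 : q.1 @[q --> p] --> p.1 by exact: cvg_fst.
have c2 : q.2 @[q --> p] --> p.2 by exact: cvg_snd.
have t1 := cvg_comp _ _ c1 (@trans_continuous p.1).
have l1 := cvg_comp _ _ c1 (@lin_continuous p.1).
have t2 := cvg_comp _ _ c2 (@trans_continuous p.2).
have l2 := cvg_comp _ _ c2 (@lin_continuous p.2).
exact: cvg_pair (cvgD t1 (cvg_mulmx l1 t2)) (cvg_mulmx l1 l2).
Qed.

Lemma isom_inv_continuous : continuous (fun g : isom R n => g^-1%g).
Proof.
apply: continuous_comp_initial => g.
have lT : (lin h)^T @[h --> g] --> (lin g)^T.
  exact: cvg_trmx (@lin_continuous g).
exact: cvg_pair (cvgN (cvg_mulmx lT (@trans_continuous g))) lT.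
Qed.

End IsomMetric.

(** A nonempty set of naturals has a least element, so [min_nat] does not fall back on its default
    value. *)
Lemma min_nat_in (A : set nat) (a : nat) : A a -> A (min_nat A).
Proof.
move=> Aa; have exA : exists m, `[< A m >] by exists a; apply/asboolP.
have [m /asboolP Am mmin] := ex_minnP exA.
suff [] : (A `&` lbound A) (min_nat A) by [].
apply: xgetPex; exists m; split=> // x Ax.
by rewrite leEnat; apply: mmin; apply/asboolP.
Qed.

Lemma min_nat_le (A : set nat) (a : nat) : A a -> (min_nat A <= a)%N.
Proof.
move=> Aa; rewrite /min_nat; case: xgetP => // m -> [_ /(_ _ Aa)].
by rewrite leEnat.
Qed.

(** * Words and word length *)

Section Words.
Context {R : realType} {n : nat}.
Implicit Types (S : set (isom R n)) (g h x : isom R n).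
Local Open Scope group_scope.

Lemma is_word1 S : is_word S 1 0.
Proof. by exists [::]; split=> //; rewrite big_nil. Qed.

Lemma is_word_letter S x : S x \/ S x^-1 -> is_word S x 1.
Proof.
move=> Sx; exists [:: x]; split=> //; last by rewrite big_seq1.
by move=> y; rewrite inE => /eqP ->.
Qed.

Lemma is_word_mul S g h k m :
  is_word S g k -> is_word S h m -> is_word S (g * h) (k + m).
Proof.
move=> [u [<- Su ->]] [w [<- Sw ->]]; exists (u ++ w).
split; rewrite ?size_cat ?big_cat // => x.
by rewrite mem_cat => /orP[/Su|/Sw].
Qed.

Lemma is_word_inv S g k : is_word S g k -> is_word S g^-1 k.
Proof.
move=> [w [<- Sw ->]]; elim: w Sw => [|x w IH] Sw.
  by rewrite big_nil invg1; exact: is_word1.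
rewrite big_cons invgM /= -addn1; apply: is_word_mul.
  by apply: IH => y yw; apply: Sw; rewrite inE yw orbT.
apply: is_word_letter; rewrite invgK.
by have [] := Sw x (mem_head _ _); [right|left].
Qed.

Lemma is_wordS S g k : is_word S g k.+1 <->
  exists h x, [/\ is_word S h k, S x \/ S x^-1 & g = h * x].
Proof.
split=> [[w]|[h [x [wh Sx ->]]]]; last first.
  by rewrite -addn1; apply: is_word_mul wh (is_word_letter Sx).
case/lastP: w => [[]//|w x [+ Sw ->]].
rewrite size_rcons => -[wk]; exists (\prod_(y <- w) y), x.
split; last by rewrite -cats1 big_cat /= big_seq1.
  by exists w; split=> // y yw; apply: Sw; rewrite mem_rcons inE yw orbT.
by apply: Sw; rewrite mem_rcons mem_head.
Qed.

(** Words of length [k.+1] are the image under multiplication of a product of compact sets: the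
    words of length [k], and [S] with its inverses. *)
Lemma is_word_compact S k : compact S -> compact [set g | is_word S g k].
Proof.
move=> cS; have cS1 : compact (S `|` [set x^-1 | x in S]).
  apply: compactU => //; apply: continuous_compact => //.
  exact/continuous_subspaceT/isom_inv_continuous.
elim: k => [|k IH].
  rewrite (_ : [set g | _] = [set 1]); first exact: compact_set1.
  apply/seteqP; split=> [g [w [/size0nil -> _ ->]]|_ -> /=].
    by rewrite big_nil.
  exact: is_word1.
have := continuous_compact (continuous_subspaceT (@isom_mul_continuous R n))
  (compact_setX IH cS1).
congr compact; apply/seteqP; split=> [_ [[h x] [/= hk Sx] <-]|g].
  apply/is_wordS; exists h, x; split=> //.
  by case: Sx => [|[y Sy <-]]; [left|right; rewrite invgK].
move=> /is_wordS[h [x [hk Sx ->]]]; exists (h, x) => //=; split=> //=.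
by case: Sx; [left|right; exists x^-1; rewrite ?invgK].
Qed.

Lemma is_word_closed S k : compact S -> closed [set g | is_word S g k].
Proof.
move=> cS; apply: compact_closed; first exact: isom_hausdorff.
exact: is_word_compact.
Qed.

Lemma word_length_le S g k : is_word S g k -> (word_length S g <= k)%N.
Proof. exact: min_nat_le. Qed.

Lemma word_lengthP S g k : is_word S g k -> is_word S g (word_length S g).
Proof. exact: (@min_nat_in [set m | is_word S g m]). Qed.

End Words.

(** * A Baire category argument in a locally compact subgroup *)

Section Baire.
Context {R : realType} {n : nat}.
Variable H : set (isom R n).
Hypotheses (subgroupH : group_closed [in H])
  (loccptH : locally_compact [set: set_type H]).

Lemma subgroup1 : H 1%g.
Proof. by have [+ _] := subgroupH; rewrite inE. Qed.

Lemma subgroup_div g h : H g -> H h -> H (g / h)%g.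
Proof.
move=> Hg Hh; have [_] := subgroupH.
by move=> /(_ g h); rewrite !inE; exact.
Qed.

Lemma subgroupV g : H g -> H g^-1%g.
Proof. by rewrite -[g^-1%g]mul1g; exact/subgroup_div/subgroup1. Qed.

Lemma subgroupM g h : H g -> H h -> H (g * h)%g.
Proof.
move=> Hg Hh; rewrite -[h]invgK; apply: subgroup_div => //; exact: subgroupV.
Qed.

Lemma compact_nbhs1 : exists2 e : R, 0 < e &
  exists C : set (isom R n), [/\ compact C, C `<=` H &
    forall h, H h -> isom_dist 1%g h < e -> C h].
Proof.
pose one : set_type H := SigSub (mem_set subgroup1).
have [U] := loccptH (x := one) I; rewrite withinET => nU [cU _].
have [V [[B oB <-] /= B1 BU]] := nU.
have /nbhs_isomP[e e0 eB] : nbhs (1%g : isom R n) B by exact: open_nbhs_nbhs.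
exists e => //; exists (set_val @` U); split.
- apply: continuous_compact => //; apply: continuous_subspaceT.
  exact: initial_continuous.
- by move=> _ [x _ <-]; exact: set_valP.
- move=> h Hh h1; exists (SigSub (mem_set Hh)) => //.
  exact/BU/eB.
Qed.

(** If no [W k] contained a ball of [H], there would be nested closed balls centred in [H], the
    first inside a compact subset of [H], each avoiding one more [W k]. A cluster point of the
    centres lies in [H] and in all the balls, hence in no [W k]. *)
Lemma baire_subgroup (W : nat -> set (isom R n)) :
  (forall k, closed (W k)) -> (forall h, H h -> exists k, W k h) ->
  exists k g (e : R), [/\ H g, 0 < e &
    forall h, H h -> isom_dist g h < e -> W k h].
Proof.
move=> clW HW; apply: contrapT => noball.
have [r r0 [C [cC CH rC]]] := compact_nbhs1.
pose state := (nat * isom R n * R)%type.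
pose ok (s : state) := H s.1.2 /\ 0 < s.2.
(* The relation is vacuous from states that are not [ok], so every state has a successor, as
   dependent choice demands. *)
pose next (s t : state) := ok s -> [/\ ok t, t.1.1 = s.1.1.+1 &
  forall h, isom_dist t.1.2 h <= t.2 ->
    isom_dist s.1.2 h <= s.2 /\ ~ W s.1.1 h].
have exnext s : {t | next s t}.
  apply: cid; case: s => -[k g] e.
  have [[/= Hg e0]|nok] := pselect (ok (k, g, e)); last first.
    by exists (k, g, e) => /nok.
  have [h [Hh gh nWh]] : exists h, [/\ H h, isom_dist g h < e & ~ W k h].
    apply: contrapT => noh; apply: noball; exists k, g, e; split=> // h Hh gh.
    by apply: contrapT => nWh; apply: noh; exists h.
  have /nbhs_isomP[d d0 hd] : nbhs h (~` W k).
    by apply: open_nbhs_nbhs; split=> //; exact: closed_openC.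
  (* [d / 2] keeps the closed ball off [W k]; [e - isom_dist g h] keeps it inside the previous
     ball. *)
  exists (k.+1, h, Num.min (d / 2) (e - isom_dist g h)) => _; split=> //.
    by split=> //=; rewrite lt_min divr_gt0 //= subr_gt0.
  move=> x /=; rewrite le_min => /andP[hx1 hx2]; split.
    have := isom_dist_triangle g h x; lra.
  by apply: hd; lra.
have [s [s0 sS]] := dependent_choice exnext (0%N, 1%g, r / 2).
have oks k : ok (s k).
  elim: k => [|k IH]; last by have [] := sS k IH.
  by rewrite s0; split; [exact: subgroup1|rewrite /= divr_gt0].
have sk k : (s k).1.1 = k.
  by elim: k => [|k IH]; rewrite ?s0 //; have [_ -> _] := sS k (oks k); rewrite IH.
pose B k := [set h | isom_dist (s k).1.2 h <= (s k).2].
have Bsub k j : B (k + j)%N `<=` B k.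
  elim: j => [|j IH]; rewrite ?addn0 // addnS => h Bh; apply: IH.
  by have [_ _ /(_ h Bh)[]] := sS (k + j)%N (oks _).
have Bcenter k : B k (s k).1.2.
  by rewrite /B /= isom_distxx; have [_ /ltW] := oks k.
have Cs : ((fun k => (s k).1.2) @ \oo) C.
  exists 0%N => //= k _; have [Hk _] := oks k; apply: rC => //.
  have := Bsub 0%N k _ (Bcenter k); rewrite /B /= s0 /=; lra.
have [x [Cx clx]] := cC _ _ Cs.
(* From index [k] on, all centres lie in the closed ball [B k], so their cluster point does too. *)
have Bx k : B k x.
  rewrite /B /= leNgt; apply/negP => xk.
  pose d := isom_dist (s k).1.2 x - (s k).2.
  have nx : nbhs x [set h | isom_dist x h < d].
    by apply/nbhs_isomP; exists d => //; rewrite subr_gt0.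
  have nB : ((fun k => (s k).1.2) @ \oo) (B k).
    by exists k => //= j /= kj; rewrite -(subnKC kj); exact/Bsub/Bcenter.
  have [h [Bh xh]] := clx _ _ nB nx.
  have := isom_dist_triangle (s k).1.2 h x; rewrite (isom_distC h).
  by move: Bh xh; rewrite /B /d /=; lra.
have [k Wx] := HW x (CH x Cx).
have [_ _ /(_ x (Bx k.+1))[_]] := sS k (oks k).
by rewrite sk.
Qed.

End Baire.

(** * The translation lattice *)

Section Lattice.
Context {R : realType} {n : nat}.
Variable H : set (isom R n).
Hypothesis subgroupH : group_closed [in H].
Implicit Types (g h k t : isom R n) (v w : 'cV[R]_n).

Local Notation L := (translation_lattice H).

Fact translation_subproof v : orthogonal_mx (v, 1%:M : 'M[R]_n).2.
Proof. by rewrite /orthogonal_mx /= trmx1 mulmx1. Qed.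

Definition translation v : isom R n := Isom (translation_subproof v).

Lemma trans_translation v : trans (translation v) = v. Proof. by []. Qed.

Lemma lin_translation v : lin (translation v) = 1%:M. Proof. by []. Qed.

Lemma translationD v w : translation (v + w) = (translation v * translation w)%g.
Proof.
by apply: isom_eq; rewrite ?transM ?linM !(trans_translation, lin_translation)
  !mul1mx.
Qed.

Lemma latticeP v : L v <-> H (translation v).
Proof.
split=> [[t [Ht lt <-]]|Hv]; last by exists (translation v).
by rewrite (_ : translation _ = t) //; apply: isom_eq.
Qed.

Lemma lattice0 : L 0.
Proof.
apply/latticeP; have -> : translation 0 = 1%g by exact: isom_eq.
exact: subgroup1.
Qed.

Lemma latticeB v w : L v -> L w -> L (v - w).
Proof.
move=> /latticeP Hv /latticeP Hw; apply/latticeP.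
have -> : translation (v - w) = (translation v / translation w)%g.
  by rewrite -[v in RHS](subrK w) [in RHS]translationD mulgK.
exact: subgroup_div.
Qed.

Lemma latticeD v w : L v -> L w -> L (v + w).
Proof.
by move=> Lv Lw; rewrite -[w]opprK -[- w]sub0r; do ?apply: latticeB => //;
  exact: lattice0.
Qed.

(** Conjugation by [h] turns translation by [v] into translation by [lin h *m v]. *)
Lemma lattice_lin h v : H h -> L v -> L (lin h *m v).
Proof.
move=> Hh /latticeP Hv; apply/latticeP.
have -> : translation (lin h *m v) = (h * translation v / h)%g.
  apply: isom_eq; rewrite !(transM, linM, transV, linV) /=
    !(trans_translation, lin_translation) mulmx1 ?lin_orthogonalV //.
  by rewrite mulmxN mulmxA lin_orthogonalV mul1mx addrAC subrr add0r.
by apply: subgroup_div => //; exact: subgroupM.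
Qed.

Lemma latticeMn v m : L v -> L (v *+ m).
Proof.
move=> Lv; elim: m => [|m IH]; first by rewrite mulr0n; exact: lattice0.
by rewrite mulrS; exact: latticeD.
Qed.

Lemma real_span_subset (A : set 'cV[R]_n) v : A v -> real_span A v.
Proof.
move=> Av; exists 1%N, (fun=> 1), (fun=> v); split=> //.
by rewrite big_ord1 scale1r.
Qed.

Lemma real_spanZ (A : set 'cV[R]_n) (c : R) v :
  real_span A v -> real_span A (c *: v).
Proof.
move=> [k [a [l [Al ->]]]]; exists k, (fun i => c * a i), l; split=> //.
by rewrite scaler_sumr; apply: eq_bigr => i _; rewrite scalerA.
Qed.

Hypothesis splitH : split_subgroup H.

(** In the splitting of [h], the translation factor carries [trans h] and the spherical factor
    carries [lin h]. *)
Lemma split_decomp h : H h -> L (trans h) /\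
  exists2 k, spherical_part H k & lin k = lin h /\ h = (translation (trans h) * k)%g.
Proof.
move=> Hh; have [[_ _ surj] _ _] := splitH.
have [[t k] /= [[Ht /= lt] [Hk /= tk]] e] := surj h Hh.
have th : trans h = trans t by rewrite -e transM tk mulmx0 addr0.
have lh : lin h = lin k by rewrite -e linM lt mul1mx.
split; first by rewrite th; exists t.
exists k => //; split=> //; rewrite -e; congr (_ * _)%g.
by rewrite e th; apply: isom_eq.
Qed.

End Lattice.

(** * Comparison of word length with translation norm *)

Section Length.
Context {R : realType} {n : nat}.
Variables H S : set (isom R n).
Hypotheses (subgroupH : group_closed [in H])
  (loccptH : locally_compact [set: set_type H])
  (genS : compact_generating_set H S).
Implicit Types (g h k t : isom R n) (v w : 'cV[R]_n).

Local Notation L := (translation_lattice H).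

Lemma generated_word h : H h -> is_word S h (word_length S h).
Proof. by move=> Hh; have [_ _ /(_ h Hh)[m]] := genS; exact: word_lengthP. Qed.

Lemma word_lengthM g h : H g -> H h ->
  (word_length S (g * h)%g <= word_length S g + word_length S h)%N.
Proof.
by move=> Hg Hh; apply/word_length_le/is_word_mul; exact: generated_word.
Qed.

(** [trans] is bounded on the compact set [S], so each further letter changes the translation by a
    bounded amount. *)
Lemma word_length_trans : exists2 M : nat, (0 < M)%N &
  forall h, H h -> `|trans h| <= (M * word_length S h)%:R.
Proof.
have [cS SH _] := genS.
have cT : compact [set trans s | s in S].
  by apply: continuous_compact cS; exact/continuous_subspaceT/trans_continuous.
have [r r0 bS] := pinfty_ex_gt0 (compact_bounded cT).
pose M0 := (Num.truncn r).+1.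
have SM s : S s -> `|trans s| <= M0%:R.
  move=> Ss; apply: le_trans (ltW (truncnS_gt r)).
  by apply: bS; exists s.
have letter x : S x \/ S x^-1%g -> `|trans x| <= (n.+1 * M0)%:R.
  case=> Sx; first by rewrite (le_trans (SM x Sx)) // ler_nat leq_pmull.
  rewrite -[x]invgK transV normrN.
  rewrite (le_trans (mx_norm_mul _ _)) // mx_norm_tr natrM ler_pM ?mulr_ge0 //.
  - rewrite -[leRHS]mulr1 ler_pM // ?ler_nat //.
    exact/orthogonal_mx_norm/lin_orth.
  - exact: SM.
(* One factor [n.+1] comes from inverse letters, the other from the linear part of the word before
   the last letter. *)
exists (n.+1 * (n.+1 * M0))%N => [|h /generated_word]; first by rewrite !muln_gt0.
elim: (word_length S h) {1 3}h => [|m IH] g; rewrite ?muln0.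
  by move=> [w [/size0nil -> _ ->]]; rewrite big_nil trans1 normr0.
move=> /is_wordS[g' [x [/IH wg' Sx ->]]]; rewrite transM mulnS natrD.
rewrite [leRHS]addrC (le_trans (ler_normD _ _)) // lerD //.
rewrite (le_trans (orthogonal_mul_norm _ (lin_orth _))) // natrM.
by rewrite ler_pM // ?ler_nat // letter.
Qed.

(** By Baire, the words of some length [k] contain a ball of [H] around some [g]. For [h] near 1
    this ball contains [g] and [g * h], so [h] is a word of length [k + k]. *)
Lemma short_near1 : exists2 e : R, 0 < e & exists N : nat,
  forall h, H h -> isom_dist 1%g h <= e -> (word_length S h <= N)%N.
Proof.
have [cS _ HS] := genS.
have [] := baire_subgroup subgroupH loccptH
  (W := fun k : nat => [set g | is_word S g k]).
- by move=> k; exact: is_word_closed.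
- by move=> h /HS.
move=> k [g [e [Hg e0 /= ge]]]; exists (e / n.+2%:R); first exact: divr_gt0.
exists (k + k)%N => h Hh h1; apply: word_length_le.
rewrite -[h](mulKg g); apply: is_word_mul.
  by apply/is_word_inv/ge => //; rewrite isom_distxx.
apply: ge; first exact: subgroupM.
rewrite -{1}[g]mulg1 (le_lt_trans (isom_dist_mull _ _ _)) //.
rewrite (@le_lt_trans _ _ (n%:R * (e / n.+2%:R))) ?ler_wpM2l //.
by rewrite mulrCA gtr_pMr // ltr_pdivrMr // mul1r ltr_nat.
Qed.

Lemma isom_grid (r d : R) : 0 < d ->
  exists (F : finType) (c : isom R n -> F), forall g h,
    `|trans g| <= r -> `|trans h| <= r -> c g = c h -> isom_dist g h <= d.
Proof.
move=> d0; have [F1 [c1 c1P]] := @mx_grid R n 1 r d d0.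
have [F2 [c2 c2P]] := @mx_grid R n n 1 d d0.
exists (F1 * F2)%type, (fun g => (c1 (trans g), c2 (lin g))).
move=> g h gr hr [c1gh c2gh]; apply: isom_dist_le; first exact: c1P.
by apply: c2P => //; exact/orthogonal_mx_norm/lin_orth.
Qed.

(** A grid cuts the bounded part of [H] into finitely many classes of small diameter. If [g]
    represents the class of [h], then [g^-1 * h] is near 1, hence short. *)
Lemma bounded_length (r : R) : exists N : nat,
  forall h, H h -> `|trans h| <= r -> (word_length S h <= N)%N.
Proof.
have [e e0 [N0 short]] := short_near1.
have d0 : 0 < e / n.+1%:R by exact: divr_gt0.
have [F [c cP]] := isom_grid r d0.
have /fin_all_exists[N NP] : forall f : F, exists m : nat, forall h,
    H h -> `|trans h| <= r -> c h = f -> (word_length S h <= m)%N.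
  move=> f; have [[g [Hg gr cg]]|nog] := pselect (exists g, [/\ H g,
      `|trans g| <= r & c g = f]); last first.
    by exists 0%N => h Hh hr ch; case: nog; exists h.
  exists (word_length S g + N0)%N => h Hh hr ch.
  have Hgh : H (g^-1 * h)%g by apply: subgroupM => //; exact: subgroupV.
  rewrite -[h](mulVKg g) (leq_trans (word_lengthM _ _)) // leq_add2l short //.
  rewrite -(mulVg g) (le_trans (isom_dist_mull _ _ _)) //.
  have gh : isom_dist g h <= e / n.+1%:R by apply: cP => //; rewrite cg.
  rewrite (le_trans (ler_wpM2l _ gh)) // mulrCA ger_pMr //.
  by rewrite ler_pdivrMr // mul1r ler_nat.
exists (\max_f N f)%N => h Hh hr.
by rewrite (leq_trans (NP (c h) h Hh hr erefl)) // leq_bigmax.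
Qed.

(* Walk from 0 to [v] by unit steps, staying close to the lattice. *)
Lemma translation_length : exists K : nat, forall (N : nat) v,
  L v -> `|v| <= N%:R -> (word_length S (translation v) <= K * N.+1)%N.
Proof.
have [D D0 coarse] := real_span_coarse (lattice0 subgroupH)
  (fun v w => latticeB subgroupH (v := v) (w := w)).
(* Lattice vectors close to consecutive points of the walk differ by at most [D + 1 + D]. *)
have [K KP] := bounded_length (D + 1 + D).
exists K => N v Lv vN.
suff walk m q w : real_span L q -> `|q| <= m%:R -> L w -> `|q - w| <= D ->
    (word_length S (translation w) <= K * m.+1)%N.
  by apply: (walk N v) => //; [exact: real_span_subset|rewrite subrr normr0].
elim: m q w {N v Lv vN} => [|m IH] q w Vq qm Lw qw.
  move: qm qw; rewrite muln1 normr_le0 => /eqP ->; rewrite sub0r normrN => wD.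
  by apply: KP; [exact/latticeP|rewrite trans_translation; lra].
(* Shrinking [q] towards 0 gives the previous point of the walk, at distance at most 1. *)
pose q' := (m%:R / m.+1%:R) *: q.
have Vq' : real_span L q' by exact: real_spanZ.
have q'm : `|q'| <= m%:R.
  rewrite normrZ ger0_norm ?divr_ge0 // mulrAC ler_pdivrMr //.
  by rewrite ler_wpM2l.
have qq' : `|q - q'| <= 1.
  rewrite -{1}[q]scale1r -scalerBl normrZ -natr1.
  rewrite -{1}(@divff _ (m%:R + 1)) ?lt0r_neq0 ?natr1 //.
  rewrite -mulrBl -natr1 addrAC subrr add0r mul1r ger0_norm ?invr_ge0 ?natr1 //.
  by rewrite mulrC ler_pdivrMr // mul1r.
have [w' Lw' qw'] := coarse q' Vq'.
rewrite mulnS addnC -[w](subrK w') translationD.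
rewrite (leq_trans (word_lengthM _ _)) //; try exact/latticeP/latticeB.
  exact/latticeP.
rewrite addnC leq_add //; first exact: IH Vq' q'm Lw' qw'.
apply: KP; first exact/latticeP/latticeB.
rewrite trans_translation.
have -> : w - w' = (w - q) + (q - q') + (q' - w') by rewrite !subrKA.
rewrite (le_trans (ler_normD _ _)) // lerD // (le_trans (ler_normD _ _)) //.
by rewrite lerD // distrC.
Qed.

End Length.

(** * The essential part *)

Section EssentialPart.
Context {R : realType} {n : nat}.
Variable H : set (isom R n).
Hypothesis subgroupH : group_closed [in H].
Implicit Types (g h : isom R n) (v w : 'cV[R]_n).

Local Notation L := (translation_lattice H).
Local Notation V := (real_span L).
Local Notation "'ess' h" :=
  (sigL V (fun v => lin h *m v) : {ptws V -> ('cV[R]_n : topologicalType)})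
  (at level 10, h at level 9).

Lemma essP g h : ess g = ess h <-> forall v, L v -> lin g *m v = lin h *m v.
Proof.
split=> [gh v Lv|gh].
  have Vv := real_span_subset Lv.
  by have /(congr1 (fun f => f (SigSub (mem_set Vv)))) := gh.
apply/funext => -[v Vv]; suff : lin g *m v = lin h *m v by [].
have [k [a [l [Ll ->]]]] := set_mem Vv; rewrite !mulmx_sumr.
by apply: eq_bigr => i _; rewrite -!scalemxAr gh.
Qed.

Lemma ess_div g h :
  ess g = ess h <-> forall v, L v -> lin (g^-1 * h)%g *m v = v.
Proof.
split=> [/essP gh v Lv|gh].
  by rewrite linM -mulmxA -gh // mulmxA linV lin_orthogonal mul1mx.
apply/essP => v Lv; rewrite -[in LHS](gh v Lv) linM linV.
by rewrite !mulmxA lin_orthogonalV mul1mx.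
Qed.

Lemma ess_continuous : continuous (fun h => ess h).
Proof.
move=> h; apply: (pointwise_cvgP (F := (ess g) @[g --> h]) (ess h)
  (fmap_filter _ (nbhs_filter h))).2 => -[v Vv].
exact: cvg_mulmx (@lin_continuous _ _ h) (cvg_cst v).
Qed.

Lemma spherical1 : spherical_part H 1%g.
Proof. by split; first exact: subgroup1. Qed.

Lemma spherical_div g h :
  spherical_part H g -> spherical_part H h -> spherical_part H (g^-1 * h)%g.
Proof.
move=> [Hg /= tg] [Hh /= th]; split.
  by apply: subgroupM => //; exact: subgroupV.
by rewrite /= transM transV tg th !mulmx0 oppr0 addr0.
Qed.

Lemma spherical_exp g m : spherical_part H g -> spherical_part H (g ^+ m)%g.
Proof.
move=> [Hg /= tg]; elim: m => [|m [IH /= tm]]; first exact: spherical1.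
rewrite expgS; split; first exact: subgroupM.
by rewrite /= transM tg tm mulmx0 addr0.
Qed.

(* The identity being isolated in the essential part can be tested on elements
   of the spherical part that are close to 1 in O(n), not just in O(V). *)
Definition essentially_isolated (d : R) := forall h, spherical_part H h ->
  isom_dist 1%g h <= d -> forall v, L v -> lin h *m v = v.

(* When 1 is isolated at scale [d], elements of the same class agree on V: this
   replaces the finiteness of the essential part. *)
Lemma spherical_classes (d : R) : 0 < d ->
  exists (F : finType) (c : isom R n -> F),
  forall g h, spherical_part H g -> spherical_part H h -> c g = c h ->
    spherical_part H (g^-1 * h)%g /\ isom_dist 1%g (g^-1 * h)%g <= d.
Proof.
move=> d0; have d1 : 0 < d / n.+1%:R by exact: divr_gt0.
have [F [c cP]] := @isom_grid R n 0 _ d1; exists F, c => g h Kg Kh cgh.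
split; first exact: spherical_div.
rewrite -(mulVg g) (le_trans (isom_dist_mull _ _ _)) //.
have [[_ /= tg] [_ /= th]] := (Kg, Kh).
rewrite (le_trans (ler_wpM2l _ (cP g h _ _ cgh))) ?tg ?th ?normr0 //.
rewrite mulrCA ger_pMr // ler_pdivrMr // mul1r ler_nat.
exact: leqnSn.
Qed.

(** Forwards, an isolating neighbourhood of the identity is pulled back along the continuous map
    [ess]. Backwards, each of finitely many classes yields one element of the essential part, which
    is thus finite in a Hausdorff space. *)
Lemma essential_part_discrete :
  discrete_set (essential_part H) <-> exists2 d, 0 < d & essentially_isolated d.
Proof.
split=> [disc|[d d0 dP]].
  have /disc[_ [U nU UE]] : essential_part H (ess 1%g).
    by exists 1%g => //; exact: spherical1.
  have /nbhs_isomP[e e0 eU] := ess_continuous nU.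
  exists (e / 2) => [|h Kh h1 v Lv]; first exact: divr_gt0.
  have : (U `&` essential_part H) (ess h).
    by split; [apply: eU; lra|exists h].
  by rewrite UE => /essP ->; rewrite ?lin1 ?mul1mx.
have [F [c cP]] := spherical_classes d0.
have finE : finite_set (essential_part H).
  (* One value is selected for each class; classes without members default to [ess 1]. *)
  pose r f := xget (ess 1%g) [set x | exists2 h, spherical_part H h &
    c h = f /\ ess h = x].
  apply: (@sub_finite_set _ _ (r @` setT)); last exact/finite_image/finite_finset.
  move=> _ [h Kh <-]; exists (c h) => //; rewrite /r.
  case: xgetP => [_ -> [g Kg [cg <-]]|/(_ (ess h))[]]; last by exists h.
  apply/ess_div; apply/dP; first exact: spherical_div.
  by have [] := cP g h Kg Kh cg.
have hausV : hausdorff_space {ptws V -> ('cV[R]_n : topologicalType)}.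
  by apply: hausdorff_product => x; exact: norm_hausdorff.
move=> x Ex; split; first exact: mem_set.
exists (~` (essential_part H `\ x)).
  apply: open_nbhs_nbhs; split; last by move=> [_]; exact.
  have /accessible_finite_set_closed clE := hausdorff_accessible hausV.
  by rewrite openC; apply: clE; exact: finite_setD.
apply/seteqP; split=> [y [ny Ey]|_ ->]; last by split=> // -[_]; exact.
by apply: contrapT => yx; apply: ny.
Qed.

(** Pigeonhole: among the powers of [h] up to the number of classes, two share a class, and their
    quotient acts trivially on [L]. *)
Lemma spherical_finite_order (d : R) : 0 < d -> essentially_isolated d ->
  exists J : nat, forall h, spherical_part H h ->
    exists j, [/\ (0 < j)%N, (j <= J)%N &
      forall v, L v -> lin (h ^+ j)%g *m v = v].
Proof.
move=> d0 dP; have [F [c cP]] := spherical_classes d0; exists #|F| => h Kh.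
pose f (i : 'I_#|F|.+1) := c (h ^+ i)%g.
have [i [k [lt_ik fik]]] : exists i k : 'I_#|F|.+1, (i < k)%N /\ f i = f k.
  have /injectivePn[i [k ik fik]] : ~~ injectiveb f.
    by apply/negP => /injectiveP /leq_card; rewrite card_ord ltnn.
  move: ik; rewrite neq_ltn => /orP[|] lt_ik; first by exists i, k.
  by exists k, i.
exists (k - i)%N; split; first by rewrite subn_gt0.
  by rewrite leq_subLR (leq_trans (leq_ord k)) // leq_addl.
have -> : (h ^+ (k - i) = (h ^+ i)^-1 * h ^+ k)%g.
  by rewrite -{2}(subnKC (ltnW lt_ik)) expgnDr mulKg.
have [Kik dik] := cP _ _ (spherical_exp i Kh) (spherical_exp k Kh) fik.
exact: dP.
Qed.

(** The lattice fixed by [h] depends only on the class of [h], so finitely many such lattices occur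
    and one constant serves them all. *)
Lemma fixed_coarse (d : R) : 0 < d -> essentially_isolated d ->
  exists2 D, 0 <= D & forall h, spherical_part H h ->
    forall q, real_span [set v | L v /\ lin h *m v = v] q ->
      exists2 w, L w /\ lin h *m w = w & `|q - w| <= D.
Proof.
move=> d0 dP; have [F [c cP]] := spherical_classes d0.
have /fin_all_exists2[D D0 DP] : forall f : F, exists2 D, 0 <= D &
    forall h, spherical_part H h -> c h = f ->
    forall q, real_span [set v | L v /\ lin h *m v = v] q ->
      exists2 w, L w /\ lin h *m w = w & `|q - w| <= D.
  move=> f; have [[g Kg cg]|nog] := pselect (exists2 g,
      spherical_part H g & c g = f); last by exists 0 => // h Kh ch; case: nog; exists h.
  have [||D D0 DP] := @real_span_coarse _ _ [set v | L v /\ lin g *m v = v].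
  - by split; [exact: lattice0|rewrite mulmx0].
  - move=> v w [Lv gv] [Lw gw]; split; first exact: latticeB.
    by rewrite mulmxBr gv gw.
  exists D => // h Kh ch.
  have /essP gh : ess g = ess h.
    apply/ess_div/dP; first exact: spherical_div.
    by have [] := cP g h Kg Kh (etrans cg (esym ch)).
  have -> : [set v | L v /\ lin h *m v = v] = [set v | L v /\ lin g *m v = v].
    by apply/seteqP; split=> v [Lv vE]; split=> //; rewrite -?gh // gh.
  by move=> q /DP[w [Lw gw] qw]; exists w => //; split=> //; rewrite -gh.
exists (\sum_f D f) => [|h Kh q /(DP (c h) h Kh erefl)[w hw qw]].
  exact: sumr_ge0.
exists w => //; rewrite (le_trans qw) // (bigD1 (c h)) //= lerDl.
exact: sumr_ge0.
Qed.

(** Telescoping: each further power adds the image of [v - lin h *m v] under an orthogonal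
    matrix. *)
Lemma norm_sub_exp h v m :
  `|v - lin (h ^+ m)%g *m v| <= m%:R * (n%:R * `|v - lin h *m v|).
Proof.
elim: m => [|m IH].
  by rewrite expg0 lin1 mul1mx subrr normr0 mul0r.
have -> : v - lin (h ^+ m.+1)%g *m v =
    (v - lin (h ^+ m)%g *m v) + lin (h ^+ m)%g *m (v - lin h *m v).
  by rewrite mulmxBr mulmxA -linM -expgSr addrA subrK.
rewrite -natr1 mulrDl mul1r (le_trans (ler_normD _ _)) // lerD //.
exact/orthogonal_mul_norm/lin_orth.
Qed.

(* Subtracting from [s] a lattice vector fixed by [h] and close to the average of
   [s] under the powers of [h] makes it comparable to [s - h s]. *)
Lemma short_preimage (d : R) : 0 < d -> essentially_isolated d ->
  exists C D, [/\ 0 <= C, 0 <= D & forall h s, spherical_part H h -> L s ->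
    exists2 s', L s' & s' - lin h *m s' = s - lin h *m s /\
      `|s'| <= C * `|s - lin h *m s| + D].
Proof.
move=> d0 dP; have [J JP] := spherical_finite_order d0 dP.
have [D D0 DP] := fixed_coarse d0 dP.
exists (J%:R * n%:R), D; split=> // h s Kh Ls.
have [Hh _] := Kh; have [j [j0 jJ hj]] := JP h Kh.
(* As [h ^+ j] acts trivially on [L], applying [h] permutes the terms cyclically, so [w] is a
   lattice vector fixed by [h]. *)
pose w := \sum_(i < j) lin (h ^+ i)%g *m s.
have Lw : L w.
  apply: (big_ind L) => [||i _]; [exact: lattice0|exact: latticeD|].
  by apply: lattice_lin => //; have [] := spherical_exp i Kh.
have hw : lin h *m w = w.
  have := telescope_sumr (fun i => lin (h ^+ i)%g *m s) (leq0n j).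
  rewrite hj // expg0 lin1 mul1mx subrr big_mkord => telescope.
  apply/eqP; rewrite -subr_eq0 /w mulmx_sumr -sumrB -[X in _ == X]telescope.
  by apply/eqP/eq_bigr => i _; rewrite expgS linM mulmxA.
pose q := j%:R^-1 *: w.
have j0R : 0 < j%:R :> R by rewrite ltr0n.
have [|f [Lf hf] qf] := DP h Kh q; first exact/real_spanZ/real_span_subset.
exists (s - f); first exact: latticeB.
split; first by rewrite mulmxBr hf opprB addrA subrK.
rewrite -(subrKA q) (le_trans (ler_normD _ _)) // lerD //.
(* [s - q] is the average of the displacements of [s] under the powers of [h], each bounded by
   [norm_sub_exp]. *)
have -> : s - q = j%:R^-1 *: \sum_(i < j) (s - lin (h ^+ i)%g *m s).
  rewrite sumrB sumr_const card_ord scalerBr -[s *+ j]scaler_nat scalerA.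
  rewrite mulVf ?scale1r //.
  by rewrite gt_eqF.
rewrite normrZ ger0_norm ?invr_ge0 // [leLHS]mulrC ler_pdivrMr //.
rewrite (le_trans (ler_norm_sum _ _ _)) //.
rewrite [leRHS]mulr_natr -[X in _ *+ X]card_ord -sumr_const ler_sum // => i _.
rewrite (le_trans (norm_sub_exp _ _ _)) // -mulrA ler_wpM2r ?mulr_ge0 //.
by rewrite ler_nat (leq_trans (ltnW (ltn_ord i))).
Qed.

End EssentialPart.

(** * Conjugator length *)

Section ConjugatorLength.
Context {R : realType} {n : nat}.
Variables H S : set (isom R n).
Hypotheses (subgroupH : group_closed [in H])
  (loccptH : locally_compact [set: set_type H])
  (splitH : split_subgroup H)
  (genS : compact_generating_set H S).
Implicit Types (g h : isom R n) (v w : 'cV[R]_n).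

Local Notation L := (translation_lattice H).

Lemma conjugatorsP h h' g : conjugators H h h' g <->
  [/\ H g, trans g + lin g *m trans h = trans h' + lin h' *m trans g &
      lin g *m lin h = lin h' *m lin g].
Proof.
split=> [[Hg e]|[Hg et el]].
  have gh : (g * h = h' * g)%g by rewrite -e mulgVK.
  by split=> //; [have := congr1 trans gh|have := congr1 lin gh].
split=> //; have -> : (g * h = h' * g)%g by exact: isom_eq.
exact: mulgK.
Qed.

Lemma conj_length_le h h' g :
  conjugators H h h' g -> (conj_length H S h h' <= word_length S g)%N.
Proof. by move=> hg; apply: min_nat_le; exists g. Qed.

Lemma conj_length_min h h' : conjugators H h h' !=set0 ->
  exists2 g, conjugators H h h' g & word_length S g = conj_length H S h h'.
Proof.
move=> [g hg].
by apply: (@min_nat_in [set word_length S k | k in conjugators H h h']); exists g.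
Qed.

Local Open Scope ereal_scope.

Lemma CL_le (m : nat) (c : \bar R) :
  (forall h h', H h -> H h' -> conjugators H h h' !=set0 ->
    (word_length S h + word_length S h' <= m)%N ->
    ((conj_length H S h h')%:R)%:E <= c) -> CL H S m <= c.
Proof.
move=> le_c; apply: ge_ereal_sup => _ [[h h'] /= [Hh Hh' hh' len] <-].
exact: le_c.
Qed.

Lemma CL_ge (m : nat) h h' : H h -> H h' -> conjugators H h h' !=set0 ->
  (word_length S h + word_length S h' <= m)%N ->
  ((conj_length H S h h')%:R)%:E <= CL H S m.
Proof. by move=> Hh Hh' hh' len; apply: ereal_sup_ubound; exists (h, h'). Qed.

Lemma CL_ge0 (m : nat) : 0 <= CL H S m.
Proof.
have H1 := subgroup1 subgroupH.
have len1 : word_length S 1%g = 0%N.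
  by apply/eqP; rewrite -leqn0; exact/word_length_le/is_word1.
apply: le_trans (@CL_ge m 1%g 1%g _ _ _ _) => //; rewrite ?lee_fin ?len1 //.
by exists 1%g; split; rewrite // mul1g mulgV.
Qed.

Lemma CL_mono (m m' : nat) : (m <= m')%N -> CL H S m <= CL H S m'.
Proof.
move=> mm'; apply: CL_le => h h' Hh Hh' hh' len; apply: CL_ge => //.
exact: leq_trans mm'.
Qed.

Local Close Scope ereal_scope.

(** The commutator of translation by [v] with [h] is translation by [v - lin h *m v]. *)
Lemma parts_commuteP :
  parts_commute H <-> forall h v, spherical_part H h -> L v -> lin h *m v = v.
Proof.
split=> [comm h v Kh [t Tt <-]|fix_L t h [Ht /= lt] Kh].
  have [[_ /= lt] [_ /= th]] := (Tt, Kh).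
  have /(congr1 trans) := comm t h Tt Kh.
  by rewrite !transM lt th !mul1mx addr0 add0r.
have Lt : L (trans t) by exists t.
have [_ /= th] := Kh; apply: isom_eq; rewrite ?transM ?linM.
  by rewrite (fix_L h) // lt th mul1mx addr0 add0r.
by rewrite lt mul1mx mulmx1.
Qed.

(** Supplies the test pairs for both lower bounds: translation by [v] is one conjugator, and all
    others are determined up to vectors fixed by [lin h] in their translation. *)
Lemma translation_conjugate h v : spherical_part H h -> L v ->
  [/\ H (translation (v - lin h *m v) * h)%g,
      conjugators H h (translation (v - lin h *m v) * h)%g !=set0 &
      forall g, conjugators H h (translation (v - lin h *m v) * h)%g g ->
        trans g - lin h *m trans g = v - lin h *m v].
Proof.
move=> [Hh /= th] Lv; have Lhv := lattice_lin subgroupH Hh Lv; split.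
- by apply: subgroupM => //; exact/latticeP/latticeB.
- exists (translation v); apply/conjugatorsP; split; first exact/latticeP.
    rewrite !(transM, linM) !(trans_translation, lin_translation) th.
    by rewrite !mulmx0 !mul1mx !addr0 subrK.
  by rewrite !linM !lin_translation !mul1mx mulmx1.
- move=> g /conjugatorsP[_ + _].
  rewrite !(transM, linM) !(trans_translation, lin_translation) th.
  by rewrite !mulmx0 !mul1mx !addr0 => e; rewrite {1}e addrK.
Qed.

Lemma translation_lengthMn v k : L v ->
  (word_length S (translation (v *+ k)) <= word_length S (translation v) * k)%N.
Proof.
move=> Lv; apply: word_length_le; elim: k => [|k IH].
  rewrite muln0 mulr0n (_ : translation 0 = 1%g); first exact: is_word1.
  exact: isom_eq.
rewrite mulrS translationD mulnS; apply: is_word_mul => //.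
exact/(generated_word genS)/latticeP.
Qed.

(** For the pair built from [v *+ k], lengths are affine in [k], while a conjugator [g] satisfies
    [trans g - lin h *m trans g = u *+ k]. Hence [g] has translation norm at least [k |u| / n.+1],
    and length at least this divided by [M]. *)
Lemma CL_lower : ~ parts_commute H -> exists (a b : nat) (c : R),
  0 < c /\ forall k : nat, ((c * k%:R)%:E <= CL H S (a * k + b)%N)%E.
Proof.
move=> ncomm; have [h [v [Kh Lv hv]]] : exists h v,
    [/\ spherical_part H h, L v & lin h *m v != v].
  apply: contrapT => nohv; apply/ncomm/parts_commuteP => h v Kh Lv.
  by apply/eqP/negP => /negP hv; apply: nohv; exists h, v.
have [Hh _] := Kh; have [M M0 MP] := word_length_trans genS.
pose u := v - lin h *m v.
have Lu : L u by apply: latticeB => //; exact: lattice_lin.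
have u0 : 0 < `|u| by rewrite normr_gt0 subr_eq0 eq_sym.
have Mn0 : 0 < (n.+1 * M)%:R :> R by rewrite ltr0n muln_gt0.
exists (word_length S (translation u)), (word_length S h + word_length S h)%N.
exists (`|u| / (n.+1 * M)%:R); split=> [|k]; first exact: divr_gt0.
have uk : v *+ k - lin h *m (v *+ k) = u *+ k by rewrite raddfMn -mulrnBl.
have [] := translation_conjugate Kh (latticeMn subgroupH k Lv).
rewrite uk => Hhk conj conjP.
have Luk := latticeMn subgroupH k Lu.
apply: le_trans (CL_ge _ _ conj _) => //.
  have [g gP <-] := conj_length_min conj.
  have [Hg _ _] := (conjugatorsP _ _ _).1 gP.
  rewrite lee_fin mulrAC ler_pdivrMr // mulr_natr -normrMn -(conjP g gP).
  rewrite (le_trans (ler_normB _ _)) // mulnC -natrM.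
  have := orthogonal_mul_norm (trans g) (lin_orth h).
  have /(ler_wpM2l (ler0n R n.+1)) := MP g Hg.
  rewrite -natrM mulnA mulnC -natr1 mulrDl mul1r; lra.
rewrite addnCA leq_add2l.
rewrite (leq_trans (word_lengthM genS _ Hh)) ?leq_add2r //.
  exact/latticeP.
exact: translation_lengthMn.
Qed.

(** As [lin h'] fixes the lattice, the spherical factor of any conjugator is itself a conjugator,
    and spherical elements have bounded length. *)
Lemma CL_commute : parts_commute H ->
  exists N : nat, forall m, (CL H S m <= N%:R%:E)%E.
Proof.
move=> /parts_commuteP fix_L.
have [N NP] := bounded_length subgroupH loccptH genS 0.
exists N => m; apply: CL_le => h h' Hh Hh' [g /conjugatorsP[Hg et el]] _.
have [Lg [k0 [Hk0 /= tk0] [lk0 _]]] := split_decomp splitH Hg.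
have [_ [k' Kk' [lk' _]]] := split_decomp splitH Hh'.
rewrite lee_fin ler_nat (@leq_trans (word_length S k0)) //.
  apply/conj_length_le/conjugatorsP; split; rewrite ?lk0 //.
  move: et; rewrite tk0 mulmx0 addr0 add0r -{1}lk' (fix_L k') // addrC.
  exact: addIr.
by apply: NP; rewrite // tk0 normr0.
Qed.

(** The displacement of [trans g] under [lin h'] equals [trans h' - lin g *m trans h], which is
    bounded in terms of [m]. Replacing [trans g] by a short lattice vector with the same
    displacement yields another conjugator. *)
Lemma CL_upper : discrete_set (essential_part H) ->
  exists a b : nat, forall m, (CL H S m <= (a * m + b)%:R%:E)%E.
Proof.
move=> /(essential_part_discrete subgroupH)[d d0 dP].
have [C [D [C0 D0 short]]] := short_preimage subgroupH d0 dP.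
have [M M0 MP] := word_length_trans genS.
have [K KP] := translation_length subgroupH loccptH genS.
have [N NP] := bounded_length subgroupH loccptH genS 0.
pose A := (Num.truncn C).+1; pose B := (Num.truncn D).+1.
exists (K * (A * (n.+1 * M)))%N, (K * B.+1 + N)%N => m.
apply: CL_le => h h' Hh Hh' [g /conjugatorsP[Hg et el]] len.
have [Lg [k0 [Hk0 /= tk0] [lk0 _]]] := split_decomp splitH Hg.
have [_ [k' Kk' [lk' _]]] := split_decomp splitH Hh'.
have [s Ls [sE sle]] := short k' (trans g) Kk' Lg; rewrite lk' in sE sle.
have u_le : `|trans g - lin h' *m trans g| <= (n.+1 * M * m)%:R.
  have -> : trans g - lin h' *m trans g = trans h' - lin g *m trans h.
    by apply/eqP; rewrite subr_eq addrAC eq_sym subr_eq eq_sym et.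
  rewrite (le_trans (ler_normB _ _)) //.
  rewrite (@le_trans _ _ (n.+1%:R * (`|trans h'| + `|trans h|))) //.
    rewrite mulrDr lerD ?ler_peMl // ?ler1n //.
    rewrite (le_trans (orthogonal_mul_norm _ (lin_orth g))) // ler_wpM2r //.
    by rewrite ler_nat.
  rewrite -mulnA natrM ler_wpM2l // (le_trans (lerD (MP _ Hh') (MP _ Hh))) //.
  by rewrite -natrD -mulnDr ler_nat leq_mul2l addnC len orbT.
have s_le : `|s| <= (A * (n.+1 * M * m) + B)%:R.
  rewrite (le_trans sle) // natrD natrM lerD ?ler_pM //; apply/ltW/truncnS_gt.
pose g' := (translation s * k0)%g.
have tg' : trans g' = s by rewrite transM tk0 mulmx0 addr0.
have lg' : lin g' = lin g by rewrite linM lin_translation mul1mx.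
have Hs : H (translation s) by exact/latticeP.
have g'P : conjugators H h h' g'.
  apply/conjugatorsP; rewrite tg' lg'; split=> //; first exact: subgroupM.
  rewrite -[s in LHS](subrK (lin h' *m s)) sE addrAC; congr (_ + _).
  by rewrite addrAC et addrK.
rewrite lee_fin ler_nat (leq_trans (conj_length_le g'P)) //.
rewrite (leq_trans (word_lengthM genS Hs Hk0)) // addnA leq_add //.
  rewrite (leq_trans (KP _ s Ls s_le)) // -addnS mulnDr.
  by rewrite !mulnA.
by apply: NP; rewrite // tk0 normr0.
Qed.

Lemma CL_infinite : ~ discrete_set (essential_part H) ->
  exists m0 : nat, forall m, (m0 <= m)%N -> CL H S m = +oo%E.
Proof.
move=> ndisc; have [N NP] := bounded_length subgroupH loccptH genS 2.
have [M M0 MP] := word_length_trans genS.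
have [p [l [Ll spanL]]] := real_span_finite L.
(* Both elements of the pair will have translation norm at most 2, hence length at most [N]. *)
exists (N + N)%N => m Nm; apply: eq_infty => c.
apply: (@le_trans _ _ (`|c|%:E)); first by rewrite lee_fin ler_norm.
(* [q] is a norm that every conjugator will have to reach: the first term forces length at least
   [|c|], the second makes [u] of norm at most 1. *)
pose q : R := M%:R * (`|c| + 1) + \sum_i `|l i|.
have q0 : 0 < q.
  by rewrite ltr_pwDl ?sumr_ge0 // mulr_gt0 ?ltr0n // ltr_wpDl.
(* At this scale, [h] moves each [v] by at most [|v| / q]. *)
pose d : R := (n.+1%:R * q)^-1.
have d0 : 0 < d by rewrite invr_gt0 mulr_gt0.
have ndx (x : R) : 0 <= x -> n%:R * d * x <= x / q.
  move=> x0; rewrite mulrC ler_wpM2l // /d invfM mulrA ger_pMl ?invr_gt0 //.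
  by rewrite ler_pdivrMr // mul1r ler_nat.
(* If every [h] this close to 1 fixed all the [l i], it would fix their span, and the essential part
   would be discrete. *)
have [h [i [Kh hd hl]]] : exists h i,
    [/\ spherical_part H h, isom_dist 1%g h <= d & lin h *m l i != l i].
  apply: contrapT => nohi; apply: ndisc; apply/essential_part_discrete => //.
  exists d => // h Kh hd v Lv; have [a ->] := spanL v (real_span_subset Lv).
  rewrite mulmx_sumr; apply: eq_bigr => i _; rewrite -scalemxAr.
  by congr (_ *: _); apply/eqP/negP => /negP hl; apply: nohi; exists h, i.
have hv v : `|v - lin h *m v| <= n%:R * d * `|v|.
  rewrite -{1}[v]mul1mx -mulmxBl (le_trans (mx_norm_mul _ _)) //.
  rewrite ler_wpM2r // ler_wpM2l // (le_trans _ hd) //.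
  by rewrite -lin1 isom_dist_lin.
pose u := l i - lin h *m l i.
have u0 : 0 < `|u| by rewrite normr_gt0 subr_eq0 eq_sym.
have u1 : `|u| <= 1.
  rewrite (le_trans (hv _)) // (le_trans (ndx _ _)) // ler_pdivrMr // mul1r.
  have sum0 : 0 <= \sum_(j | j != i) `|l j| by exact: sumr_ge0.
  have Mc0 : 0 <= M%:R * (`|c| + 1) by rewrite mulr_ge0 ?addr_ge0.
  by rewrite /q (bigD1 i) //=; lra.
(* This multiple brings the norm of [u *+ k] into [[1, 2]]. *)
pose k := (Num.truncn `|u|^-1).+1.
have /andP[k1 k2] : (1 <= k%:R * `|u|) && (k%:R * `|u| <= 2).
  have /andP[t1 t2] := truncn_itv (ltW (etrans (invr_gt0 _) u0)).
  rewrite -ler_pdivrMr // mul1r ltW //= /k -natr1 mulrDl mul1r -[2]/(1 + 1).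
  by rewrite lerD // -ler_pdivlMr // mul1r.
have uk : l i *+ k - lin h *m (l i *+ k) = u *+ k by rewrite raddfMn -mulrnBl.
have [] := translation_conjugate Kh (latticeMn subgroupH k (Ll i)).
rewrite uk => Hhk conj conjP; have [Hh /= th] := Kh.
apply: le_trans (CL_ge Hh Hhk conj _).
  have [g gP <-] := conj_length_min conj.
  have [Hg _ _] := (conjugatorsP _ _ _).1 gP.
  have kq : k%:R * `|u| <= `|trans g| / q.
    rewrite mulr_natl -normrMn -(conjP g gP) (le_trans (hv _)) //.
    exact: ndx.
  have := le_trans k1 kq; rewrite ler_pdivlMr // mul1r => qg.
  have := le_trans qg (MP g Hg).
  have : 0 <= \sum_i `|l i| by exact: sumr_ge0.
  rewrite natrM lee_fin /q => sum0 qM.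
  have : M%:R * `|c| <= M%:R * (word_length S g)%:R :> R.
    by have : 0 <= M%:R :> R by []; lra.
  by rewrite ler_pM2l ?ltr0n.
apply: leq_trans Nm; apply: leq_add; apply: NP => //.
  by rewrite th normr0.
by rewrite transM trans_translation th mulmx0 addr0 normrMn -[leLHS]mulr_natl.
Qed.

End ConjugatorLength.

(** * From bounds on [CL] to growth rates *)

Section GrowthRates.
Context {R : realType} {n : nat}.
Variables H S : set (isom R n).
Hypotheses (subgroupH : group_closed [in H])
  (loccptH : locally_compact [set: set_type H])
  (splitH : split_subgroup H)
  (genS : compact_generating_set H S).

Lemma absz_ceil_bounds (r : R) :
  0 <= r -> r <= (`|Num.ceil r|%N)%:R /\ (`|Num.ceil r|%N)%:R <= r + 1.
Proof.
move=> r0; have c0 : 0 <= Num.ceil r by rewrite -(ceil0 R) ceil_le.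
rewrite natr_absz ger0_norm //; split; first exact: ceil_ge.
rewrite -lerBlDr ltW // -[X in _ - X]/(1%:~R) -intrB.
by rewrite ltNge -ceil_le_int -ltNge ltrBlDr ltzD1.
Qed.

Lemma CL_real_nat (k : nat) : CL_real H S (k%:R : R) = CL H S k.
Proof. by rewrite /CL_real -[k%:R]/(k%:Z%:~R) intrKceil absz_nat. Qed.

(** Domination says something only where [C * k + D] is nonnegative, hence the threshold [k0]. *)
Lemma quasi_dominated_nat (f : R -> \bar R) : quasi_dominated (CL_real H S) f ->
  exists C D : R, 0 < C /\ exists k0 : nat, forall k, (k0 <= k)%N ->
    (CL H S k <= C%:E * f (C * k%:R + D)%R + D%:E)%E.
Proof.
move=> [C [D [C0 fP]]]; exists C, D; split=> //.
exists (Num.truncn (`|D| / C)).+1 => k k0; rewrite -CL_real_nat; apply: fP => //.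
have := truncnS_gt (`|D| / C); rewrite ltr_pdivrMr // mulrC => Dk.
have : C * (Num.truncn (`|D| / C)).+1%:R <= C * k%:R.
  by rewrite ler_wpM2l ?(ltW C0) // ler_nat.
by have := ler_norm (- D); rewrite normrN; lra.
Qed.

Lemma trivial_growth_commute : parts_commute H -> trivial_growth (CL_real H S).
Proof.
move=> /(CL_commute subgroupH loccptH splitH genS)[N NP].
exists N%:R => //; split.
  by exists 1, 0; split=> // r _ _; rewrite mul1e adde0; exact: NP.
exists 1, N%:R; split=> // r _ _; rewrite mul1e -[leLHS]add0e leeD2r //.
exact: CL_ge0.
Qed.

Lemma not_trivial_growth : ~ parts_commute H -> ~ trivial_growth (CL_real H S).
Proof.
move=> /(CL_lower subgroupH genS)[a [b [c [c0 low]]]] [x _ [dom _]].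
have [C [D [C0 [k0 kP]]]] := quasi_dominated_nat dom.
pose k := ((Num.truncn ((C * x + D) / c)).+1 + k0)%N.
(* With [a.+1] in place of [a], the index passes [k0] even when [a] is 0. *)
have k_le : (k <= a.+1 * k + b)%N by rewrite mulSn -addnA leq_addr.
have /kP : (k0 <= a.+1 * k + b)%N by rewrite (leq_trans _ k_le) // leq_addl.
rewrite -EFinM -EFinD leNgt => /negP; apply.
have mono : (a * k + b <= a.+1 * k + b)%N.
  by rewrite leq_add2r leq_mul2r leqnSn orbT.
apply: lt_le_trans (CL_mono _ _ mono).
apply: lt_le_trans (low k); rewrite lte_fin [ltRHS]mulrC -ltr_pdivrMr //.
by rewrite (lt_le_trans (truncnS_gt _)) // ler_nat leq_addr.
Qed.

Lemma not_linear_growth : ~ discrete_set (essential_part H) ->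
  ~ linear_growth (CL_real H S).
Proof.
move=> /(CL_infinite subgroupH loccptH genS)[m0 inf] [dom _].
have [C [D [C0 [k0 kP]]]] := quasi_dominated_nat dom.
have := kP (m0 + k0)%N (leq_addl _ _).
by rewrite inf ?leq_addr // -EFinM -EFinD leye_eq.
Qed.

Lemma linear_growth_discrete : ~ parts_commute H ->
  discrete_set (essential_part H) -> linear_growth (CL_real H S).
Proof.
move=> /(CL_lower subgroupH genS)[a [b [c [c0 low]]]].
move=> /(CL_upper subgroupH loccptH splitH genS)[a' [b' up]]; split.
  (* The [1] makes the slope positive; the extra [a'] in the constant absorbs the rounding up of
     [r]. *)
  exists (a'%:R + 1), (a' + b')%:R; split=> [|r r0 _].
    by rewrite ltr_wpDl.
  rewrite (le_trans (up _)) // -EFinM -EFinD lee_fin !natrD natrM.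
  have [_ r1] := absz_ceil_bounds r0.
  have := ler_wpM2l (ler0n R a') r1; have := ler0n R a'; have := ler0n R b'.
  have : 0 <= a'%:R * a'%:R * r :> R by rewrite !mulr_ge0.
  have : 0 <= a'%:R * r by rewrite mulr_ge0.
  have : 0 <= a'%:R * (a'%:R + b'%:R) :> R by rewrite !mulr_ge0.
  nra.
(* Inside [CL], the slope [a] and the constant bring the index up to [a * k + b], where [k] is the
   ceiling of [r]; outside, [c^-1] cancels the [c] of the lower bound. *)
exists (a%:R + c^-1), (a + b)%:R; split=> [|r r0 rD].
  by rewrite ltr_wpDl ?invr_gt0.
rewrite /CL_real; set m := `|Num.ceil _|%N; pose k := `|Num.ceil r|%N.
have [rk kr] := absz_ceil_bounds r0.
have [Dm _] := absz_ceil_bounds rD.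
have km : (a * k + b <= m)%N.
  rewrite -(ler_nat R) (le_trans _ Dm) // !natrD natrM.
  have := ler_wpM2l (ler0n R a) kr.
  have : 0 <= c^-1 * r by rewrite mulr_ge0 // invr_ge0 ltW.
  rewrite /k; lra.
apply: (@le_trans _ _ ((a%:R + c^-1)%:E * (c * k%:R)%:E + (a + b)%:R%:E)%E).
  rewrite -EFinM -EFinD lee_fin mulrDl mulKf ?gt_eqF //.
  have : 0 <= a%:R * (c * k%:R) by rewrite !mulr_ge0 // ltW.
  have : 0 <= (a + b)%:R :> R by [].
  rewrite /k; lra.
rewrite leeD2r // lee_wpmul2l //.
  by rewrite lee_fin addr_ge0 // invr_ge0 ltW.
exact: le_trans (low k) (CL_mono _ _ km).
Qed.

(** In the discrete case the affine bound makes every value finite, so the set is all of the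
    naturals; otherwise only indices below [m0] can give finite values. *)
Lemma finite_CL_finite :
  finite_set [set m : nat | CL H S m <> +oo%E] <->
    ~ discrete_set (essential_part H).
Proof.
split=> [fin /(CL_upper subgroupH loccptH splitH genS)[a [b up]]|].
  apply: infinite_nat; apply: sub_finite_set fin => m _ /= CLoo.
  by have := up m; rewrite CLoo leye_eq.
move=> /(CL_infinite subgroupH loccptH genS)[m0 inf].
apply: sub_finite_set (finite_II m0) => m /= CLm.
by rewrite ltnNge; apply/negP => /inf.
Qed.

End GrowthRates.

Theorem theorem1p1 (R : realType) (n : nat) (H S : set (isom R n))
    (subgroupH : group_closed [in H])
    (loccptH : locally_compact [set: set_type H])
    (splitH : split_subgroup H)
    (genS : compact_generating_set H S) :
  [/\ trivial_growth (CL_real H S) <-> parts_commute H,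
      ~ parts_commute H ->
        (linear_growth (CL_real H S) <->
           discrete_set (essential_part H)) &
      ~ parts_commute H ->
        (finite_set [set m : nat | CL H S m <> +oo%E] <->
           ~ discrete_set (essential_part H))].
Proof.
split=> [|ncomm|_]; last exact: finite_CL_finite.
  split; last exact: trivial_growth_commute.
  by move=> triv; apply: contrapT => nc; exact: not_trivial_growth triv.
split; last exact: linear_growth_discrete.
by move=> lin; apply: contrapT => nd; exact: not_linear_growth lin.
Qed.
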